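(* Let $F:\mathbb{R}^N\to\mathbb{R}^N$ and $H:\mathbb{R}^N\to\mathbb{R}^M$ be of class $C^1$ with $F(0)=0$ and $H(0)=0$. Suppose that there exist class $C^1$ functions $q:\mathbb{R}^N\times\mathbb{R}^M\to\mathbb{R}^N$, $r:\mathbb{R}^\nu\times\mathbb{R}^M\to\mathbb{R}^\nu$, and $s:\mathbb{R}^\nu\to\mathbb{R}^\nu$ with $q(0,0)=0$, $r(0,0)=0$, and $s(0)=0$ satisfying the following three conditions: 1) the system $\dot w=s(w)$ admits a nonlinear left eigenvalue $\lambda(w)$ and an associated nonlinear left eigenvector $v(w)$ on $\mathbb{R}^\nu$; 2) the dual nonlinear Sylvester equation $$-s(-\rho(z))=\frac{\partial\rho(z)}{\partial z}F(z)+r(-\rho(z),H(z))$$ has a class $C^1$ solution $\rho:\mathbb{R}^N\to\mathbb{R}^\nu$ on $\mathbb{R}^N$ such that $\rho(0)=0$, and $$r(-\rho(z),H(z))=\frac{\partial\rho(z)}{\partial z}q(z,H(z))$$ holds for all $z\in\mathbb{R}^N$; 3) there exist $\tilde\lambda:\mathbb{R}^N\to\mathbb{C}$ of class $C^0$ and $\tilde v:\mathbb{R}^N\to\mathbb{C}^N$ of class $C^1$ such that $$\tilde\lambda(z)=\lambda(-\rho(z)),\qquad \tilde v^\top(z)=-v^\top(-\rho(z))\frac{\partial\rho(z)}{\partial z}$$ hold for all $z\in\mathbb{R}^N$, and $\tilde v^\top(z)\neq 0_{1\times N}$ for all $z\in\mathbb{R}^N$. Then $\tilde\lambda(z)$ and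 $\tilde v(z)$ are, respectively, a nonlinear left eigenvalue and its associated nonlinear left eigenvector of the closed-loop system $\dot z=\tilde F(z):=F(z)+q(z,H(z))$ on $\mathbb{R}^N$.
   Context: Definition (nonlinear left eigenvalue/eigenvector). Let $s:\mathbb{R}^d\to\mathbb{R}^d$ be of class $C^1$ with $s(0)=0$ and let $D\subseteq\mathbb{R}^d$. A class $C^0$ function $\lambda:D\to\mathbb{C}$ and a class $C^1$ function $v:D\to\mathbb{C}^d\setminus\{0_{d\times 1}\}$ are called, respectively, a nonlinear left eigenvalue and an associated nonlinear left eigenvector of $\dot w=s(w)$ on $D$ if $$v^\top(w)\frac{\partial s(w)}{\partial w}+\left(\frac{\partial v(w)}{\partial w}s(w)\right)^\top=\lambda(w)v^\top(w)$$ for all $w\in D$. Here $^\top$ denotes the (non-conjugate) transpose, $N,M,\nu$ are positive integers, and $C^k$ means $k$ times continuously differentiable. *)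

(* Defs.v *)
(* R is any realType, and points of R^d are column vectors 'cV[R]_d. *)
From HB Require Import structures.
From mathcomp Require Import all_boot all_order all_algebra.
From mathcomp Require Import complex.
From mathcomp Require Import all_classical all_reals all_analysis.

Set Implicit Arguments.
Unset Strict Implicit.
Unset Printing Implicit Defensive.

Import Order.TTheory GRing.Theory Num.Theory.
Import numFieldNormedType.Exports.

Local Open Scope classical_set_scope.
Local Open Scope ring_scope.

(* V is meant to be finite-dimensional (a 'cV[R]_n or a product of two of
   them): there, continuity of x |-> 'd f x h for every direction h is
   continuity of the differential in operator norm. Functions are total and
   differentiability is taken in the ambient space V, so this is the usual
   class C^1 on D when D is open, in particular when D = setT. *)
Definition C1_on (R : realType) (V W : normedModType R) (D : set V)
    (f : V -> W) : Prop :=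
  (forall x, D x -> differentiable f x) /\
  (forall h, {within D, continuous (fun x => 'd f x h)}).

Definition C1 (R : realType) (V W : normedModType R) (f : V -> W) : Prop :=
  C1_on setT f.

(* The library's 'J acts on row vectors and is the transpose of the usual
   Jacobian; here entry (i, j) is the partial derivative of f_i in x_j. *)
Definition jac (R : realType) (n m : nat) (f : 'cV[R]_n -> 'cV[R]_m)
    (x : 'cV[R]_n) : 'M[R]_(m, n) :=
  \matrix_(i < m, j < n) ('d f x (delta_mx j 0)) i 0.

Definition cplx_mx (R : realType) (m n : nat) (A : 'M[R]_(m, n)) :
    'M[R[i]]_(m, n) :=
  map_mx (real_complex R) A.

Definition re_part (R : realType) (n m : nat) (v : 'cV[R]_n -> 'cV[R[i]]_m) :
    'cV[R]_n -> 'cV[R]_m :=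
  fun x => map_mx (@complex.Re R) (v x).

Definition im_part (R : realType) (n m : nat) (v : 'cV[R]_n -> 'cV[R[i]]_m) :
    'cV[R]_n -> 'cV[R]_m :=
  fun x => map_mx (@complex.Im R) (v x).

(* The cast selects the topology given by the modulus on R[i]. *)
Definition C0C_on (R : realType) (n : nat) (D : set 'cV[R]_n)
    (l : 'cV[R]_n -> R[i]) : Prop :=
  {within D, continuous (l : 'cV[R]_n -> (R[i] : numFieldType))}.

(* R[i] is a normed module over itself but not over R in the library, so real
   differentiability of complex-valued maps goes through real and imaginary
   parts. *)
Definition C1C_on (R : realType) (n m : nat) (D : set 'cV[R]_n)
    (v : 'cV[R]_n -> 'cV[R[i]]_m) : Prop :=
  C1_on D (re_part v) /\ C1_on D (im_part v).

Definition jacC (R : realType) (n m : nat) (v : 'cV[R]_n -> 'cV[R[i]]_m)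
    (x : 'cV[R]_n) : 'M[R[i]]_(m, n) :=
  \matrix_(i < m, j < n)
    (jac (re_part v) x i j +i* jac (im_part v) x i j)%C.

(* The first two fields are the standing assumptions on the vector field. *)
Record nonlinear_left_eigenpair (R : realType) (d : nat)
    (s : 'cV[R]_d -> 'cV[R]_d) (D : set 'cV[R]_d)
    (lambda : 'cV[R]_d -> R[i]) (v : 'cV[R]_d -> 'cV[R[i]]_d) : Prop :=
  NonlinearLeftEigenpair {
    nle_C1 : C1 s;
    nle_s0 : s 0 = 0;
    nle_lambdaC0 : C0C_on D lambda;
    nle_vC1 : C1C_on D v;
    nle_v_neq0 : forall w, D w -> v w <> 0;
    nle_eq : forall w, D w ->
      (v w)^T *m cplx_mx (jac s w) + (jacC v w *m cplx_mx (s w))^T =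
      lambda w *: (v w)^T
  }.

(* Main.v *)
(* With sigma = - rho and G the closed-loop field, the Sylvester equation says
   that d sigma (G z) = s (sigma z), and vt is the pullback of the 1-form v
   along sigma. The eigenvector equation reads "Lie derivative of v along s is
   lambda v", so everything follows once the Lie derivative is known to commute
   with the pullback. As sigma is only C^1, d sigma cannot be differentiated.
   But fix z, put c = v (sigma z) and phi = c^T sigma: then
   d phi = vt^T - (v o sigma - c)^T d sigma, where vt is differentiable and the
   last term is the product of a function vanishing at z and a continuous one,
   so d phi is differentiable at z. The second differential of phi at z is then
   symmetric, and evaluating it at (h, G z) both ways gives the identity. *)
Require Import Defs.
From HB Require Import structures.
From mathcomp Require Import all_boot all_order all_algebra.
From mathcomp Require Import complex.
From mathcomp Require Import all_classical all_reals all_analysis.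
From mathcomp Require Import ring.
Set Implicit Arguments.
Unset Strict Implicit.
Import Order.TTheory GRing.Theory Num.Theory.
Import numFieldNormedType.Exports.
Local Open Scope classical_set_scope.
Local Open Scope ring_scope.

(** * First-order expansions and differentials of products *)

Lemma differentiable_dist_le (R : realType) (V W : normedModType R)
    (f : V -> W) (x : V) (e : R) :
  differentiable f x -> 0 < e ->
  exists2 d : R, 0 < d & forall y : V, `|y| < d ->
    `|f (y + x) - f x - 'd f x y| <= e * `|y|.
Proof.
move=> /diff_locallyP[_ /eqaddoP H] e0.
have /nbhs_normP[d /= d0 Hd] := H _ e0.
exists d => // y yd; rewrite -addrA -opprD; apply: Hd => /=.
by rewrite sub0r normrN.
Qed.

(** First-order expansions with a continuous linear part are unique, so the little-o estimate both
    proves differentiability and identifies [df]. *)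
Lemma is_diff_dist_le (R : realType) (V W : normedModType R)
    (f : V -> W) (df : {linear V -> W}) (x : V) :
  continuous df ->
  (forall e : R, 0 < e -> \forall y \near (0 : V),
    `|f (y + x) - f x - df y| <= e * `|y|) ->
  is_diff x f df.
Proof.
move=> dfc H.
have E : f \o shift x = cst (f x) + df +o_ (0 : V) id.
  apply/eqaddoP => e e0 /=; near=> y; rewrite /= opprD addrA; near: y; exact: H.
apply: DiffDef; last exact: diff_unique.
apply/diff_locallyP.
by rewrite (diff_unique dfc E).
Unshelve. all: by end_near. Qed.

Lemma is_diff_sum (R : realType) (V W : normedModType R) n
    (f df : 'I_n -> V -> W) (x : V) :
  (forall i, is_diff x (f i) (df i)) ->
  is_diff x (fun w => \sum_i f i w) (fun h => \sum_i df i h).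
Proof.
move=> fi; rewrite (_ : (fun w => _) = \sum_i f i); last first.
  by apply/funext => w; rewrite fct_sumE.
rewrite (_ : (fun h => _) = \sum_i df i); last first.
  by apply/funext => w; rewrite fct_sumE.
elim/big_ind2: _ => [|? ? ? ? ? ?|//].
  exact: is_diff_cst.
exact: is_diffD.
Qed.

Lemma is_diff_entry (R : realType) (V : normedModType R) m n
    (f df : V -> 'M[R]_(m, n)) (x : V) i j :
  is_diff x f df -> is_diff x (fun w => f w i j) (fun h => df h i j).
Proof.
move=> fx.
have lin : linear (fun M : 'M[R]_(m, n) => M i j).
  by move=> a M N; rewrite !mxE.
pose L := GRing.isLinear.Build _ _ _ _ _ lin.
pose l : {linear 'M[R]_(m, n) -> R} :=
  HB.pack (fun M : 'M[R]_(m, n) => M i j) L.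
have cl : continuous l by move=> M; exact: coord_continuous.
have dl : is_diff (f x) l l.
  by apply: DiffDef; [exact: linear_differentiable|rewrite diff_lin].
exact: (is_diff_comp fx dl).
Qed.

Lemma is_diff_entryB (R : realType) (V : normedModType R) m n
    (f df : V -> 'M[R]_(m, n)) (x : V) i j (c : R) :
  is_diff x f df -> is_diff x (fun w => f w i j - c) (fun h => df h i j).
Proof.
move=> fx; apply: is_diff_eq.
  exact: (is_diffB (is_diff_entry i j fx) (is_diff_cst c x)).
by apply/funext => h; exact: subr0.
Qed.

(** Continuity of [g] at [x] suffices because [f x = 0] makes [f (y + x)] of order [|y|]: multiplied
    by the increment of [g], which tends to 0, it is negligible, and what remains is [g x] times the
    expansion of [f]. *)
Lemma is_diffM_vanishing (R : realType) (V : normedModType R)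
    (f df g : V -> R) (x : V) :
  is_diff x f df -> f x = 0 -> {for x, continuous g} ->
  is_diff x (fun w => f w * g w) (fun h => df h * g x).
Proof.
move=> fdf f0 gx; have fx : differentiable f x by exact: ex_diff.
rewrite (_ : (fun h => _ * g x) = g x \*: 'd f x); last first.
  by rewrite diff_val; apply/funext => h /=; rewrite mulrC.
apply: is_diff_dist_le.
  by move=> y; apply: cvgZl_tmp; exact: diff_continuous.
move=> e e0.
have [k k0 dk] := linear_lipschitz (diff_continuous fx).
(* Near [x], [|f|] is at most [(k + 1) * |y|]: [k] bounds the differential and 1 is the precision
   chosen for the expansion in [H1]. The other [+ 1] keeps the divisor positive when [g x = 0]. *)
have k10 : 0 < k + 1 by rewrite addr_gt0.
have g10 : 0 < `|g x| + 1 by rewrite ltr_pwDr.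
have a0 : 0 < e / 2 / (k + 1) by rewrite !divr_gt0.
have b0 : 0 < e / 2 / (`|g x| + 1) by rewrite !divr_gt0.
have [d1 d10 H1] := differentiable_dist_le fx ltr01.
have [d2 d20 H2] := differentiable_dist_le fx b0.
have [d3 /= d30 H3] : exists2 d, 0 < d & forall y : V,
    `|y| < d -> `|g (y + x) - g x| < e / 2 / (k + 1).
  have /cvgrPdist_lt/(_ _ a0)/nbhs_normP[d /= d0 Hd] := gx.
  exists d => // y yd; rewrite distrC; apply: Hd => /=.
  by rewrite opprD addrCA subrr addr0 normrN.
near=> y.
have y1 : `|y| < d1 by near: y; exact: nbhs0_lt.
have y2 : `|y| < d2 by near: y; exact: nbhs0_lt.
have y3 : `|y| < d3 by near: y; exact: nbhs0_lt.
have fy : `|f (y + x)| <= (k + 1) * `|y|.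
  have := H1 _ y1; rewrite f0 subr0 mul1r => {}H1.
  rewrite -[f _](subrK ('d f x y)) (le_trans (ler_normD _ _))//.
  by rewrite addrC mulrDl mul1r lerD.
have -> : f (y + x) * g (y + x) - f x * g x - (g x \*: 'd f x) y =
  f (y + x) * (g (y + x) - g x) + g x * (f (y + x) - f x - 'd f x y).
  by rewrite /= f0 /GRing.scale/=; ring.
rewrite (le_trans (ler_normD _ _))// [e]splitr mulrDl lerD//.
- rewrite normrM (le_trans (ler_pM _ _ fy (ltW (H3 _ y3))))//.
  by rewrite mulrAC mulrCA divff ?mulr1// lt0r_neq0.
- rewrite normrM (le_trans (ler_wpM2l _ (H2 _ y2)))// mulrA ler_wpM2r//.
  rewrite mulrCA; apply: ler_piMr; first by rewrite ltW// divr_gt0.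
  by rewrite ler_pdivrMr// mul1r lerDl.
Unshelve. all: by end_near. Qed.

(** * Symmetry of the second differential at a point *)

(** The mean value theorem in the direction [h] turns the mixed difference into an increment of
    ['d f _ h], which is then expanded to first order at [x]. The derivative of ['d f _ h] is thus
    used at the single point [x]. *)
Lemma mixed_difference (R : realType) (V : normedModType R) (f : V -> R)
    (x h k : V) (e : R) :
  (forall w, differentiable f w) ->
  differentiable (fun w => 'd f w h) x -> 0 < e ->
  \forall t \near 0^'+,
   `|f (t *: h + t *: k + x) - f (t *: k + x) - f (t *: h + x) + f x
      - t ^+ 2 * 'd (fun w => 'd f w h) x k| <= e * t ^+ 2.
Proof.
move=> fd dx e0.
(* The two expansions below cost [e' * t * (|h| + |k|)] and [e' * t * |h|]; the divisor is their
   total weight, plus 1 to stay positive. *)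
pose e' := e / (2 * `|h| + `|k| + 1).
have n0 : 0 < 2 * `|h| + `|k| + 1 by rewrite ltr_pwDr// addr_ge0// mulr_ge0.
have e'0 : 0 < e' by rewrite divr_gt0.
have [d d0 Hd] := differentiable_dist_le dx e'0.
set L := 'd (fun w => 'd f w h) x in Hd *.
near=> t.
have t0 : 0 < t by near: t; exact: nbhs_right_gt.
(* This puts both [u *: h + t *: k] and [u *: h], for [u] between 0 and [t], in the ball where the
   expansion holds. *)
have td : t * (`|h| + `|k| + 1) < d.
  rewrite -ltr_pdivlMr; last by rewrite ltr_pwDr// addr_ge0.
  near: t; apply: nbhs_right_lt; rewrite divr_gt0// ltr_pwDr// addr_ge0//.
pose g (u : R) := f (u *: h + t *: k + x) - f (u *: h + x).
pose dg (u : R) := 'd f (u *: h + t *: k + x) h - 'd f (u *: h + x) h.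
have line (a : V) (u : R) :
    is_derive u 1 (fun s : R => f (s *: h + a)) ('d f (u *: h + a) h).
  have H : is_diff u (fun s : R => f (s *: h + a))
      (fun s => 'd f (u *: h + a) (s *: h)).
    have aff : is_diff u (fun s : R => s *: h + a) (fun s => s *: h).
      have := is_diffD (is_diff_scalel u h) (is_diff_cst a u).
      by rewrite addr0.
    exact: (is_diff_comp aff (differentiableP (fd _))).
  apply: DeriveDef; first exact: diff_derivable.
  by rewrite deriveE// diff_val scale1r.
have gD (u : R) : is_derive u 1 g (dg u).
  rewrite /g; under eq_fun do rewrite -addrA.
  by rewrite /dg -addrA; exact: is_deriveB.
have [|u /[!in_itv]/= /andP[u0 ut]] := @MVT R g dg 0 t t0 (fun u _ => gD u).
  apply/continuous_subspaceT => u.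
  apply/differentiable_continuous/derivable1_diffP.
  exact: (@ex_derive _ _ _ _ _ _ _ (gD u)).
rewrite /g !scale0r !add0r subr0 opprB addrA => E.
have -> : f (t *: h + t *: k + x) - f (t *: k + x) - f (t *: h + x) + f x =
    dg u * t by rewrite -E; ring.
have nu : `|u *: h| <= t * `|h| by rewrite normrZ gtr0_norm// ler_wpM2r// ltW.
have nt : `|t *: k| = t * `|k| by rewrite normrZ gtr0_norm.
have nut : `|u *: h + t *: k| <= t * `|h| + t * `|k|.
  by rewrite (le_trans (ler_normD _ _))// nt lerD2r.
have b1 := Hd (u *: h + t *: k); have b2 := Hd (u *: h).
have {b1} b1 :
    `|'d f (u *: h + t *: k + x) h - 'd f x h - L (u *: h + t *: k)| <=
    e' * (t * `|h| + t * `|k|).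
  apply: le_trans (b1 _) _; last by rewrite ler_pM2l.
  by rewrite (le_lt_trans nut)// (le_lt_trans _ td)// -mulrDr ler_pM2l// lerDl.
have {b2} b2 : `|'d f (u *: h + x) h - 'd f x h - L (u *: h)| <=
    e' * (t * `|h|).
  apply: le_trans (b2 _) _; last by rewrite ler_pM2l.
  by rewrite (le_lt_trans nu)// (le_lt_trans _ td)// ler_pM2l// -addrA lerDl
    addr_ge0.
(* The unknown [u] drops out of the main term: [L (u *: h + t *: k) - L (u *: h) = t * L k]. *)
have -> : dg u * t - t ^+ 2 * L k =
    t * (('d f (u *: h + t *: k + x) h - 'd f x h - L (u *: h + t *: k)) -
      ('d f (u *: h + x) h - 'd f x h - L (u *: h))).
  rewrite /dg linearD [L (t *: k)]linearZ/= /GRing.scale/=; ring.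
rewrite normrM gtr0_norm// expr2 mulrCA ler_pM2l//.
rewrite (le_trans (ler_normB _ _))// (le_trans (lerD b1 b2))//.
have -> : e' * (t * `|h| + t * `|k|) + e' * (t * `|h|) =
    e' * (2 * `|h| + `|k|) * t by ring.
rewrite ler_pM2r// -[leRHS](divfK (lt0r_neq0 n0)) -/e' ler_pM2l// lerDl//.
Unshelve. all: by end_near. Qed.

(** The mixed difference is unchanged when [h] and [k] are exchanged, and divided by [t ^+ 2] it
    tends to each of the two sides. *)
Lemma second_diff_sym (R : realType) (V : normedModType R)
    (f dh dk : V -> R) (x h k : V) :
  (forall w, differentiable f w) ->
  is_diff x (fun w => 'd f w h) dh -> is_diff x (fun w => 'd f w k) dk ->
  dh k = dk h.
Proof.
move=> fd [+ <-] [+ <-] => {dh dk} dh dk.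
apply/eqP; rewrite -subr_eq0 -normr_le0; apply/ler_addgt0Pr => e e0.
rewrite add0r.
have e20 : 0 < e / 2 by rewrite divr_gt0.
near (0 : R)^'+ => t.
have t0 : 0 < t by near: t; exact: nbhs_right_gt.
have A : `|f (t *: h + t *: k + x) - f (t *: k + x) - f (t *: h + x) + f x
      - t ^+ 2 * 'd (fun w => 'd f w h) x k| <= e / 2 * t ^+ 2.
  by near: t; exact: mixed_difference.
have B : `|f (t *: k + t *: h + x) - f (t *: h + x) - f (t *: k + x) + f x
      - t ^+ 2 * 'd (fun w => 'd f w k) x h| <= e / 2 * t ^+ 2.
  by near: t; exact: mixed_difference.
have t20 : 0 < t ^+ 2 by rewrite exprn_gt0.
(* Scaled by [t ^+ 2], the two sides differ by the difference of the errors in [B] and [A], as the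
   mixed differences cancel. *)
rewrite -(ler_pM2l t20) -{1}(gtr0_norm t20) -normrM.
have -> : t ^+ 2 * ('d (fun w => 'd f w h) x k - 'd (fun w => 'd f w k) x h) =
  (f (t *: k + t *: h + x) - f (t *: h + x) - f (t *: k + x) + f x
      - t ^+ 2 * 'd (fun w => 'd f w k) x h) -
  (f (t *: h + t *: k + x) - f (t *: k + x) - f (t *: h + x) + f x
      - t ^+ 2 * 'd (fun w => 'd f w h) x k).
  rewrite [t *: k + t *: h]addrC; ring.
rewrite (le_trans (ler_normB _ _))// (le_trans (lerD B A))//.
by rewrite -mulrDl -splitr mulrC.
Unshelve. all: by end_near. Qed.

(** * Jacobian matrices and the Lie derivative of a pulled-back real 1-form *)

Lemma col_sum_delta (R : realType) n (h : 'cV[R]_n) :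
  h = \sum_j h j 0 *: delta_mx j 0.
Proof.
apply/matrixP => i j; rewrite ord1 summxE (bigD1 i)//= big1 => [|k ki].
  by rewrite !mxE !eqxx mulr1 addr0.
by rewrite !mxE eq_sym (negbTE ki) mulr0.
Qed.

Lemma diff_jac (R : realType) n m (f : 'cV[R]_n -> 'cV[R]_m)
    (x h : 'cV[R]_n) : 'd f x h = jac f x *m h.
Proof.
rewrite {1}(col_sum_delta h) linear_sum.
apply/matrixP => i j; rewrite ord1 summxE mxE.
by apply: eq_bigr => k _; rewrite linearZ !mxE mulrC.
Qed.

Lemma mulmx_delta_col (R : realType) m n (A : 'M[R]_(m, n)) i j :
  (A *m delta_mx j 0 : 'cV_m) i 0 = A i j.
Proof. by rewrite -colE mxE. Qed.

Lemma lie_derivative_pullback (R : realType) (m n : nat)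
    (v s : 'cV[R]_m -> 'cV[R]_m) (sigma : 'cV[R]_n -> 'cV[R]_m)
    (G vt : 'cV[R]_n -> 'cV[R]_n) (z : 'cV[R]_n) :
  (forall w, differentiable v w) -> (forall w, differentiable s w) ->
  C1 sigma -> differentiable G z -> differentiable vt z ->
  (forall w, jac sigma w *m G w = s (sigma w)) ->
  (forall w, (vt w)^T = (v (sigma w))^T *m jac sigma w) ->
  (vt z)^T *m jac G z + (jac vt z *m G z)^T =
  ((v (sigma z))^T *m jac s (sigma z) + (jac v (sigma z) *m s (sigma z))^T)
    *m jac sigma z.
Proof.
move=> vd sd si_C1 Gd vtd sG vtE.
have sid w : differentiable sigma w by exact: si_C1.1.
(* c, X and phi are kept opaque: with transparent bodies, unification in the
   rewrites below does not terminate in reasonable time. *)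
have [c cE] : exists c, c = v (sigma z) by exists (v (sigma z)).
have [X XE] : exists X, X = G z by exists (G z).
have [phi [phid dphiE]] : exists phi : 'cV[R]_n -> R,
    (forall w, differentiable phi w) /\
    forall w h, 'd phi w h = \sum_i c i 0 * 'd sigma w h i 0.
  pose phi w := \sum_i c i 0 *: sigma w i 0; exists phi.
  have dphi w : is_diff w phi (fun h => \sum_i c i 0 *: 'd sigma w h i 0).
    apply: is_diff_sum => i; apply: is_diffZ; apply: is_diff_entry.
    exact: differentiableP.
  split=> [w|w h]; first exact: ex_diff.
  by rewrite (@diff_val _ _ _ _ _ _ _ (dphi w)).
have cont h i : {for z, continuous (fun w => 'd sigma w h i 0)}.
  apply: (@continuous_comp _ _ _ (fun w => 'd sigma w h)
    (fun M : 'cV[R]_m => M i 0)).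
    exact: (proj2 (continuous_subspace_setT _) (si_C1.2 h) z).
  exact: coord_continuous.
have vsd : is_diff z (v \o sigma) ('d v (sigma z) \o 'd sigma z).
  exact: is_diff_comp (differentiableP (sid z)) (differentiableP (vd _)).
have ssd : is_diff z (s \o sigma) ('d s (sigma z) \o 'd sigma z).
  exact: is_diff_comp (differentiableP (sid z)) (differentiableP (sd _)).
(* Write [c] as [v (sigma w)] minus [v (sigma w) - c]: the first term gives [vt] by [vtE], the
   second vanishes at [z]. *)
have phiA w h : 'd phi w h = \sum_l h l 0 * vt w l 0 -
    \sum_i ((v \o sigma) w i 0 - c i 0) * 'd sigma w h i 0.
  rewrite dphiE.
  have -> : \sum_l h l 0 * vt w l 0 = ((vt w)^T *m h) 0 0.
    by rewrite mxE; apply: eq_bigr => l _; rewrite mxE mulrC.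
  rewrite vtE -mulmxA -diff_jac mxE -sumrB; apply: eq_bigr => i _.
  by rewrite mxE /=; ring.
have diffA h : is_diff z (fun w => 'd phi w h)
    (fun k => \sum_l h l 0 * 'd vt z k l 0
       - \sum_i 'd v (sigma z) ('d sigma z k) i 0 * 'd sigma z h i 0).
  rewrite (funext (phiA^~ h)).
  apply: is_diffB.
    apply: is_diff_sum => l; apply: is_diffZ; apply: is_diff_entry.
    exact: differentiableP.
  apply: is_diff_sum => i.
  have ed : is_diff z (fun w => (v \o sigma) w i 0 - c i 0)
      (fun k => 'd v (sigma z) ('d sigma z k) i 0).
    exact: (is_diff_entryB i 0 (c i 0) vsd).
  apply: (is_diffM_vanishing ed _ (cont h i)); rewrite cE; exact: subrr.
have phiB w : 'd phi w X = \sum_i c i 0 * (s \o sigma) w i 0 -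
    \sum_l (G w l 0 - X l 0) * 'd phi w (delta_mx l 0).
  have E : c^T *m 'd sigma w X =
      c^T *m s (sigma w) - c^T *m jac sigma w *m (G w - X).
    rewrite -mulmxA -mulmxBr; congr (_ *m _); rewrite mulmxBr sG -diff_jac.
    by rewrite opprB addrCA subrr addr0.
  rewrite (dphiE w X).
  transitivity ((c^T *m 'd sigma w X) 0 0).
    by rewrite mxE; apply: eq_bigr => i _; rewrite mxE.
  rewrite {}E [LHS]mxE; congr (_ + _).
    by rewrite mxE; apply: eq_bigr => i _; rewrite mxE.
  rewrite [LHS]mxE; congr (- _).
  rewrite mxE; apply: eq_bigr => l _.
  rewrite mulrC [(G w - X) _ _]mxE [(- X) _ _]mxE; congr (_ * _).
  rewrite (dphiE w (delta_mx l 0)) mxE; apply: eq_bigr => i _.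
  by rewrite diff_jac mulmx_delta_col [_^T _ _]mxE.
have diffB : is_diff z (fun w => 'd phi w X)
    (fun k => \sum_i c i 0 * 'd s (sigma z) ('d sigma z k) i 0
       - \sum_l 'd G z k l 0 * vt z l 0).
  rewrite (funext phiB).
  apply: is_diffB.
    apply: is_diff_sum => i; apply: is_diffZ.
    exact: (is_diff_entry i 0 ssd).
  apply: is_diff_sum => l.
  have ed : is_diff z (fun w => G w l 0 - X l 0) (fun k => 'd G z k l 0).
    exact: (is_diff_entryB l 0 (X l 0) (differentiableP Gd)).
  (* The cofactor of [G w - X] is itself a directional derivative of [phi], hence continuous at [z]
     by [diffA]. *)
  have dc : {for z, continuous (fun w => 'd phi w (delta_mx l 0))}.
    apply: differentiable_continuous; exact: (ex_diff (is_diff_def := diffA _)).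
  have phil : 'd phi z (delta_mx l 0) = vt z l 0.
    transitivity ((vt z)^T 0 l); last by rewrite mxE.
    rewrite vtE -cE dphiE mxE; apply: eq_bigr => i _.
    by rewrite diff_jac mulmx_delta_col [_^T _ _]mxE.
  rewrite -phil.
  by apply: (is_diffM_vanishing ed _ dc); rewrite XE; exact: subrr.
apply/matrixP => i j; rewrite ord1 {i}.
(* Symmetry in the directions [delta_mx j 0] and [X] is the [j]-th entry of the claim, up to moving
   terms across. *)
have := second_diff_sym phid (diffA (delta_mx j 0)) diffB.
rewrite -(sG z) -XE -!diff_jac mulmxDl -mulmxA.
have -> : \sum_l (delta_mx j 0 : 'cV[R]_n) l 0 * 'd vt z X l 0 = 'd vt z X j 0.
  rewrite (bigD1 j)//= big1 => [|l lj]; first by rewrite !mxE !eqxx mul1r addr0.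
  by rewrite !mxE (negbTE lj) mul0r.
have -> : \sum_l 'd G z (delta_mx j 0) l 0 * vt z l 0 =
    ((vt z)^T *m jac G z) 0 j.
  rewrite mxE; apply: eq_bigr => l _.
  by rewrite diff_jac mulmx_delta_col [_^T _ _]mxE mulrC.
have -> : \sum_i c i 0 * 'd s (sigma z) ('d sigma z (delta_mx j 0)) i 0 =
    (c^T *m (jac s (sigma z) *m jac sigma z)) 0 j.
  rewrite [RHS]mxE; apply: eq_bigr => i _.
  by rewrite !diff_jac mulmxA mulmx_delta_col [_^T _ _]mxE.
have -> : \sum_i 'd v (sigma z) ('d sigma z X) i 0 *
      'd sigma z (delta_mx j 0) i 0 =
    (('d v (sigma z) ('d sigma z X))^T *m jac sigma z) 0 j.
  rewrite mxE; apply: eq_bigr => i _.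
  by rewrite [in X in _ * X]diff_jac mulmx_delta_col [_^T _ _]mxE.
move=> E; rewrite [LHS]mxE [RHS]mxE -cE [(_^T) 0 j]mxE.
by move/(canRL (subrK _)): E => ->; rewrite addrA addrCA subrr addr0.
Qed.

(** * From real to complex 1-forms *)

Lemma eq_re_im_mx (R : realType) m n (A B : 'M[R[i]]_(m, n)) :
  map_mx (@complex.Re R) A = map_mx (@complex.Re R) B ->
  map_mx (@complex.Im R) A = map_mx (@complex.Im R) B -> A = B.
Proof.
move=> /matrixP re /matrixP im; apply/matrixP => i j.
move: (re i j) (im i j); rewrite !mxE.
by case: (A i j) (B i j) => a b [c d] /= -> ->.
Qed.

Lemma map_re_mulmx_cplx (R : realType) m n p (A : 'M[R[i]]_(m, n))
    (B : 'M[R]_(n, p)) :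
  map_mx (@complex.Re R) (A *m cplx_mx B) = map_mx (@complex.Re R) A *m B.
Proof.
apply/matrixP => i j; rewrite !mxE raddf_sum; apply: eq_bigr => k _.
by rewrite !mxE; case: (A i k) => a b /=; rewrite mulr0 subr0.
Qed.

Lemma map_im_mulmx_cplx (R : realType) m n p (A : 'M[R[i]]_(m, n))
    (B : 'M[R]_(n, p)) :
  map_mx (@complex.Im R) (A *m cplx_mx B) = map_mx (@complex.Im R) A *m B.
Proof.
apply/matrixP => i j; rewrite !mxE raddf_sum; apply: eq_bigr => k _.
by rewrite !mxE; case: (A i k) => a b /=; rewrite mulr0 add0r.
Qed.

Lemma map_re_jacC (R : realType) n m (v : 'cV[R]_n -> 'cV[R[i]]_m) x :
  map_mx (@complex.Re R) (jacC v x) = jac (re_part v) x.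
Proof. by apply/matrixP => i j; rewrite [LHS]mxE [jacC _ _ _ _]mxE. Qed.

Lemma map_im_jacC (R : realType) n m (v : 'cV[R]_n -> 'cV[R[i]]_m) x :
  map_mx (@complex.Im R) (jacC v x) = jac (im_part v) x.
Proof. by apply/matrixP => i j; rewrite [LHS]mxE [jacC _ _ _ _]mxE. Qed.

(** The maps [s], [sigma], [G] and their Jacobians are real, so the identity splits into the real
    lemma applied to the real and to the imaginary parts of [v] and [vt]. *)
Lemma lie_derivative_pullbackC (R : realType) (m n : nat)
    (v : 'cV[R]_m -> 'cV[R[i]]_m) (s : 'cV[R]_m -> 'cV[R]_m)
    (sigma : 'cV[R]_n -> 'cV[R]_m) (G : 'cV[R]_n -> 'cV[R]_n)
    (vt : 'cV[R]_n -> 'cV[R[i]]_n) (z : 'cV[R]_n) :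
  C1C_on setT v -> C1 s -> C1 sigma -> C1 G -> C1C_on setT vt ->
  (forall w, jac sigma w *m G w = s (sigma w)) ->
  (forall w, (vt w)^T = (v (sigma w))^T *m cplx_mx (jac sigma w)) ->
  (vt z)^T *m cplx_mx (jac G z) + (jacC vt z *m cplx_mx (G z))^T =
  ((v (sigma z))^T *m cplx_mx (jac s (sigma z)) +
     (jacC v (sigma z) *m cplx_mx (s (sigma z)))^T) *m cplx_mx (jac sigma z).
Proof.
move=> [[vRd _] [vId _]] [sd _] sC [Gd _] [[vtRd _] [vtId _]] sG vtE.
apply: eq_re_im_mx.
- rewrite map_re_mulmx_cplx !map_mxD -!map_trmx !map_re_mulmx_cplx
    -!map_trmx !map_re_jacC.
  apply: (lie_derivative_pullback (v := re_part v) (vt := re_part vt))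
    => // [w|w|||w].
  + exact: vRd.
  + exact: sd.
  + exact: Gd.
  + exact: vtRd.
  + by rewrite map_trmx vtE map_re_mulmx_cplx -map_trmx.
- rewrite map_im_mulmx_cplx !map_mxD -!map_trmx !map_im_mulmx_cplx
    -!map_trmx !map_im_jacC.
  apply: (lie_derivative_pullback (v := im_part v) (vt := im_part vt))
    => // [w|w|||w].
  + exact: vId.
  + exact: sd.
  + exact: Gd.
  + exact: vtId.
  + by rewrite map_trmx vtE map_im_mulmx_cplx -map_trmx.
Qed.

(** * Closure of the class [C1] under the operations forming the closed loop *)

Lemma C1D (R : realType) (V W : normedModType R) (f g : V -> W) :
  C1 f -> C1 g -> C1 (fun x => f x + g x).
Proof.
move=> f_C1 g_C1; have [[fd _] [gd _]] := (f_C1, g_C1).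
have fgd x : is_diff x (fun y => f y + g y) (fun h => 'd f x h + 'd g x h).
  by apply: is_diffD; apply: differentiableP; [exact: fd|exact: gd].
split=> [x _|h]; first exact: (ex_diff (is_diff_def := fgd x)).
have -> : (fun x => 'd (fun y => f y + g y) x h) =
    (fun x => 'd f x h + 'd g x h).
  by apply/funext => x;
    exact: (congr1 (fun g => g h) (diff_val (is_diff_def := fgd x))).
apply: (proj1 (continuous_subspace_setT _)) => x.
apply: cvgD; first exact: (proj2 (continuous_subspace_setT _) (f_C1.2 h) x).
exact: (proj2 (continuous_subspace_setT _) (g_C1.2 h) x).
Qed.

Lemma C1N (R : realType) (V W : normedModType R) (f : V -> W) :
  C1 f -> C1 (fun x => - f x).
Proof.
move=> f_C1; have [fd _] := f_C1.
have Nfd x : is_diff x (fun y => - f y) (fun h => - 'd f x h).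
  by apply: is_diffN; apply: differentiableP; exact: fd.
split=> [x _|h]; first exact: (ex_diff (is_diff_def := Nfd x)).
have -> : (fun x => 'd (fun y => - f y) x h) = (fun x => - 'd f x h).
  by apply/funext => x;
    exact: (congr1 (fun g => g h) (diff_val (is_diff_def := Nfd x))).
apply: (proj1 (continuous_subspace_setT _)) => x.
by apply: cvgN; exact: (proj2 (continuous_subspace_setT _) (f_C1.2 h) x).
Qed.

(** The chain rule evaluates ['d q] in the direction [(h, 'd H y h)], which moves with [y], while
    [C1] controls fixed directions only. Expanding ['d H y h] in the standard basis leaves finitely
    many fixed directions with continuous coefficients. *)
Lemma C1_comp_graph (R : realType) (V W : normedModType R) (m : nat)
    (q : V * 'cV[R]_m -> W) (H : V -> 'cV[R]_m) :
  C1 q -> C1 H -> C1 (fun x => q (x, H x)).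
Proof.
move=> q_C1 H_C1; have [[qd _] [Hd _]] := (q_C1, H_C1).
have gd x : is_diff x (fun y => (y, H y)) (fun h => (h, 'd H x h)).
  by apply: is_diff_pair; apply: differentiableP; exact: Hd.
have qgd x : is_diff x (fun y => q (y, H y))
    (fun h => 'd q (x, H x) (h, 'd H x h)).
  by apply: (is_diff_comp (gd x)); apply: differentiableP; exact: qd.
split=> [x _|h]; first exact: (ex_diff (is_diff_def := qgd x)).
have gcont : continuous (fun y => (y, H y)).
  by move=> y; apply: differentiable_continuous;
    exact: (ex_diff (is_diff_def := gd y)).
have qgc u : continuous (fun y => 'd q (y, H y) u).
  move=> y; apply: (@continuous_comp _ _ _ (fun y => (y, H y))
    (fun p => 'd q p u)).
    exact: gcont.
  exact: (proj2 (continuous_subspace_setT _) (q_C1.2 u) (y, H y)).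
have -> : (fun x => 'd (fun y => q (y, H y)) x h) =
  (fun y => 'd q (y, H y) (h, 0) +
    \sum_k 'd H y h k 0 *: 'd q (y, H y) (0, delta_mx k 0)).
  apply/funext => y.
  rewrite (congr1 (fun g => g h) (diff_val (is_diff_def := qgd y))).
  under eq_bigr do rewrite -linearZ.
  rewrite -linear_sum -linearD; congr ('d q _ _).
  have scaleE (a : R) (u : 'cV[R]_m) :
      a *: ((0, u) : V * 'cV[R]_m) = (0, a *: u).
    by transitivity (a *: (0 : V), a *: u); [|rewrite scaler0].
  under eq_bigr do rewrite scaleE.
  have inD : {morph (fun k : 'cV[R]_m => (0, k) : V * 'cV[R]_m) : a b / a + b}.
    by move=> a b; transitivity ((0 : V) + 0, a + b); [rewrite addr0|].
  rewrite -(big_morph _ inD (erefl (0, 0))) -col_sum_delta.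
  by transitivity (h + 0, 0 + 'd H y h); [rewrite addr0 add0r|].
apply: (proj1 (continuous_subspace_setT _)).
move=> x; apply: cvgD.
  exact: (qgc (h, 0) x).
apply: cvg_big => [|k _]; first exact: add_continuous.
apply: cvgZ; last exact: (qgc (0, delta_mx k 0) x).
apply: (@continuous_comp _ _ _ (fun y => 'd H y h) (fun M : 'cV[R]_m => M k 0)).
  exact: (proj2 (continuous_subspace_setT _) (H_C1.2 h) x).
exact: coord_continuous.
Qed.

Lemma jacN (R : realType) n m (f : 'cV[R]_n -> 'cV[R]_m) (x : 'cV[R]_n) :
  differentiable f x -> jac (fun y => - f y) x = - jac f x.
Proof.
move=> /differentiableP fx.
have Nfx : is_diff x (fun y => - f y) (fun h => - 'd f x h) by exact: is_diffN.
have NfE h : 'd (fun y => - f y) x h = - 'd f x h.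
  exact: (congr1 (fun g => g h) (diff_val (is_diff_def := Nfx))).
apply/matrixP => i j; rewrite [RHS]mxE [LHS]mxE NfE [LHS]mxE; congr (- _).
by rewrite [RHS]mxE.
Qed.

(** * The eigenpair of the closed loop *)

Theorem theorem3 (R : realType) (N M nu : nat)
  (N_gt0 : (0 < N)%N) (M_gt0 : (0 < M)%N) (nu_gt0 : (0 < nu)%N)
  (F : 'cV[R]_N -> 'cV[R]_N) (H : 'cV[R]_N -> 'cV[R]_M)
  (F_C1 : C1 F) (H_C1 : C1 H) (F0 : F 0 = 0) (H0 : H 0 = 0)
  (q : 'cV[R]_N * 'cV[R]_M -> 'cV[R]_N)
  (r : 'cV[R]_nu * 'cV[R]_M -> 'cV[R]_nu)
  (s : 'cV[R]_nu -> 'cV[R]_nu)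
  (q_C1 : C1 q) (r_C1 : C1 r) (s_C1 : C1 s)
  (q0 : q (0, 0) = 0) (r0 : r (0, 0) = 0) (s0 : s 0 = 0)
  (lambda : 'cV[R]_nu -> R[i]) (v : 'cV[R]_nu -> 'cV[R[i]]_nu)
  (cond1 : nonlinear_left_eigenpair s setT lambda v)
  (rho : 'cV[R]_N -> 'cV[R]_nu) (rho_C1 : C1 rho) (rho0 : rho 0 = 0)
  (cond2_sylvester : forall z : 'cV[R]_N,
     - s (- rho z) = jac rho z *m F z + r (- rho z, H z))
  (cond2_r : forall z : 'cV[R]_N,
     r (- rho z, H z) = jac rho z *m q (z, H z))
  (lambdat : 'cV[R]_N -> R[i]) (vt : 'cV[R]_N -> 'cV[R[i]]_N)
  (lambdat_C0 : C0C_on setT lambdat) (vt_C1 : C1C_on setT vt)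
  (cond3_lambda : forall z : 'cV[R]_N, lambdat z = lambda (- rho z))
  (cond3_v : forall z : 'cV[R]_N,
     (vt z)^T = - (v (- rho z))^T *m cplx_mx (jac rho z))
  (cond3_neq0 : forall z : 'cV[R]_N, (vt z)^T <> 0) :
  nonlinear_left_eigenpair (fun z => F z + q (z, H z)) setT lambdat vt.
Proof.
pose sigma z := - rho z.
have sigma_C1 : C1 sigma by exact: C1N.
have jac_sigma z : jac sigma z = - jac rho z.
  by apply: jacN; exact: rho_C1.1.
have G_C1 : C1 (fun z => F z + q (z, H z)).
  exact: (C1D F_C1 (C1_comp_graph q_C1 H_C1)).
split=> //.
- by rewrite F0 H0 q0 addr0.
- by move=> w _ vt0; apply: (cond3_neq0 w); rewrite vt0 trmx0.
move=> z _.
case: cond1 => _ _ _ v_C1 _ eigen.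
(* The sign in [cond3_v] is absorbed by [jac sigma = - jac rho], so [vt] is exactly the pullback of
   [v] along [sigma]. *)
have vtE w : (vt w)^T = (v (sigma w))^T *m cplx_mx (jac sigma w).
  by rewrite cond3_v jac_sigma /cplx_mx map_mxN mulNmx mulmxN.
rewrite (lie_derivative_pullbackC (v := v) (s := s) (sigma := sigma)) //.
  by rewrite eigen// -scalemxAl -vtE cond3_lambda.
(* [cond2_r] replaces the contribution of [q] by [r], which completes the right-hand side of the
   Sylvester equation. *)
move=> w; rewrite jac_sigma mulNmx mulmxDr -cond2_r -cond2_sylvester.
by rewrite opprK.
Qed.
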